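(* Let $A_0A_1A_2$ be a translation triangle in $\mathbf{Sol}$ with translation triangular surface $\mathcal{S}=\mathcal{S}^{\mathbf{Sol},t}_{A_0A_1A_2}$. Let $l$ be a line lying in $\mathcal{S}$ (that is, a connecting curve in $\mathcal{S}$) not through any vertex of the triangle, such that $l$ meets the translation curve $g^{\mathbf{Sol}}_{A_1A_2}$ in $Q$, $g^{\mathbf{Sol}}_{A_0A_2}$ in $R$, and $g^{\mathbf{Sol}}_{A_0A_1}$ in $P$. Then $$s_g^{\mathbf{Sol}}(A_0,P,A_1)\,s_g^{\mathbf{Sol}}(A_1,Q,A_2)\,s_g^{\mathbf{Sol}}(A_2,R,A_0)=-1.$$
   Context: Model. $\mathbf{Sol}$ is $\mathbb{R}^3$ with points $(x,y,z)$, also written $(1,x,y,z)$. The translation by $(x,y,z)$ maps $(a,b,c)\mapsto(x+ae^{-z},\,y+be^{z},\,z+c)$ and carries the origin to $(x,y,z)$. The isometries fixing the origin form a group of order 8 generated by $(x,y,z)\mapsto(x,-y,z)$ and $(x,y,z)\mapsto(y,x,-z)$. Translation curves. The unit-velocity translation curve starting at the origin with direction parameters $\phi\in(-\pi,\pi]$, $\theta\in[-\frac\pi2,\frac\pi2]$, i.e. with initial tangent $(\cos\theta\cos\phi,\cos\theta\sin\phi,\sin\theta)$, is $x(t)=-\cot\theta\cos\phi\,(e^{-t\sin\theta}-1)$, $y(t)=\cot\theta\sin\phi\,(e^{t\sin\theta}-1)$, $z(t)=t\sin\theta$ if $\theta\neq0$, and $x(t)=t\cos\phi$, $y(t)=t\sin\phi$,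 $z(t)=0$ if $\theta=0$. Translation curves starting at another point are the images of these under the translation carrying the origin to that point. Two distinct points $A,B$ determine a translation curve $g^{\mathbf{Sol}}_{AB}$ (taken as a full curve); its parameters $\phi,\theta$ are those obtained after translating $A$ to the origin and directing the curve from $A$ to $B$. The translation distance $d^{\mathbf{Sol},t}(A,B)$ is the parameter $t\ge0$ at which the unit-velocity translation curve starting at $A$ reaches $B$. Simple ratio. Let $A,P,B$ be distinct points on a translation curve, where $A$ may be assumed, after a translation, to be the origin, and let $\theta$ be the parameter of the curve. (1) If the curve does not lie in the $[x,y]$ coordinate plane (and is not in one of the cases (2), (3)), then $s_g^{\mathbf{Sol}}(A,P,B)=\dfrac{1-e^{-d^{\mathbf{Sol},t}(A,P)\sin\theta}}{e^{-d^{\mathbf{Sol},t}(A,P)\sin\theta}-e^{-d^{\mathbf{Sol},t}(A,B)\sin\theta}}$ if $P$ is between $A$ and $B$, and $s_g^{\mathbf{Sol}}(A,P,B)$ is minus this expression otherwise. (2) If the curve lies in the $[x,y]$ plane or in the $z$-axis, then $s_g^{\mathbf{Sol}}(A,P,B)=d^{\mathbf{Sol},t}(A,P)/d^{\mathbf{Sol},t}(P,B)$ if $P$ is between $A$ and $B$, and minus this otherwise. (3) If the curve lies in the $[y,z]$ plane, one applies an isometry of $\mathbf{Sol}$ fixing the origin and mapping the $[y,z]$ plane to the $[x,z]$ plane, and the simple ratio is that of the image points computed by (1). Triangle and surface. A translation triangle $A_0A_1A_2$ is given by three points not on one translation curve; its sides are the translation segments joining the vertices. The surface $\mathcal{S}^{\mathbf{Sol},t}_{A_0A_1A_2}$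 is the set of all points $P$ such that the tangent vectors at $P$ of the translation curves from $P$ to $A_0,A_1,A_2$ are coplanar (vertices included). Connecting curves. After a translation one may assume $A_0$ is the origin. Let $m$ be the map $(x,z)\mapsto(x,e^{-z})$ from the $[x,z]$ plane to the upper half-plane, and let $P^p$ denote the Euclidean orthogonal projection of a point $P$ onto the $[x,z]$ plane and $P^m=m(P^p)$. For $P_1,P_2\in\mathcal{S}^{\mathbf{Sol},t}_{A_0A_1A_2}$ the connecting curve $P_1P_2$ is defined as follows. (i) If $A_1,A_2$ both lie in the $[y,z]$ plane or both lie in the $[x,z]$ plane, it is the translation curve through $P_1,P_2$, lying in that plane. (ii) Otherwise, if $P_1^p\ne P_2^p$, let $g^{m}$ be the Euclidean line through $P_1^m,P_2^m$, let $g^{p}=m^{-1}(g^{m})$, and let $\mathcal{CS}_{P_1,P_2}$ be the cylindrical surface consisting of all lines parallel to the $y$-axis through points of $g^p$; the connecting curve is $\mathcal{S}^{\mathbf{Sol},t}_{A_0A_1A_2}\cap\mathcal{CS}_{P_1,P_2}$. (iii) Otherwise, if $P_1^p=P_2^p$, let $\mathcal{CS}_{P_1,P_2}$ be the Euclidean plane parallel to the $[y,z]$ plane containing $P_1^p$; the connecting curve is $\mathcal{S}^{\mathbf{Sol},t}_{A_0A_1A_2}\cap\mathcal{CS}_{P_1,P_2}$.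
   Formalization: Off the segment the simple ratio is minus the absolute value of the formula, with d(A,P)sin θ taken along the curve from A to P; no side may be parallel to the z-axis, and rule (3) may apply to a side only if all three sides lie in planes parallel to [y,z]. *)

(* Defs.v *)
From Stdlib Require Import Reals ClassicalEpsilon.
Open Scope R_scope.

Record Sol : Type := mkSol { px : R; py : R; pz : R }.

Definition origin : Sol := mkSol 0 0 0.

Definition trans (g p : Sol) : Sol :=
  mkSol (px g + px p * exp (- pz g)) (py g + py p * exp (pz g)) (pz g + pz p).

Definition untrans (g p : Sol) : Sol :=
  mkSol ((px p - px g) * exp (pz g)) ((py p - py g) * exp (- pz g)) (pz p - pz g).

Lemma trans_untrans (g p : Sol) : trans g (untrans g p) = p.
Proof.
  destruct g as [x y z], p as [a b c]; unfold trans, untrans; simpl.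
  f_equal; try ring; rewrite Rmult_assoc, <- exp_plus.
  - replace (z + - z) with 0 by ring. rewrite exp_0. ring.
  - replace (- z + z) with 0 by ring. rewrite exp_0. ring.
Qed.

Lemma untrans_trans (g p : Sol) : untrans g (trans g p) = p.
Proof.
  destruct g as [x y z], p as [a b c]; unfold trans, untrans; simpl.
  f_equal; try ring.
  - replace ((x + a * exp (- z) - x) * exp z) with (a * (exp (- z) * exp z)) by ring.
    rewrite <- exp_plus. replace (- z + z) with 0 by ring. rewrite exp_0. ring.
  - replace ((y + b * exp z - y) * exp (- z)) with (b * (exp z * exp (- z))) by ring.
    rewrite <- exp_plus. replace (z + - z) with 0 by ring. rewrite exp_0. ring.
Qed.

Definition params (phi theta : R) : Prop :=
  - PI < phi <= PI /\ - (PI / 2) <= theta <= PI / 2.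

Definition curve0 (phi theta t : R) : Sol :=
  if Req_dec_T theta 0
  then mkSol (t * cos phi) (t * sin phi) 0
  else mkSol (- (cos theta / sin theta) * cos phi * (exp (- (t * sin theta)) - 1))
             (cos theta / sin theta * sin phi * (exp (t * sin theta) - 1))
             (t * sin theta).

Definition curve (A : Sol) (phi theta t : R) : Sol := trans A (curve0 phi theta t).

Definition on_curve (A : Sol) (phi theta : R) (X : Sol) : Prop :=
  exists t : R, X = curve A phi theta t.

Definition reaches (A B : Sol) (u : R * R * R) : Prop :=
  let '(phi, theta, t) := u in params phi theta /\ 0 <= t /\ curve A phi theta t = B.

(* For A <> B, the values theta and t are determined by [reaches]; phi is
   determined too unless theta = +-PI/2, where the curve does not depend on it. *)
Definition connect (A B : Sol) : R * R * R :=
  epsilon (inhabits (0, 0, 0)) (reaches A B).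

Definition phi (A B : Sol) : R := fst (fst (connect A B)).
Definition theta (A B : Sol) : R := snd (fst (connect A B)).
Definition tdist (A B : Sol) : R := snd (connect A B).

Definition gcurve (A B : Sol) : Sol -> Prop := on_curve A (phi A B) (theta A B).

Definition between (A P B : Sol) : Prop :=
  exists t : R, 0 < t < tdist A B /\ P = curve A (phi A B) (theta A B) t.

Definition in_xy (G : Sol -> Prop) : Prop := forall X, G X -> pz X = 0.
Definition in_yz (G : Sol -> Prop) : Prop := forall X, G X -> px X = 0.
Definition in_z_axis (G : Sol -> Prop) : Prop := forall X, G X -> px X = 0 /\ py X = 0.

(* "Minus the formula" is read as minus its absolute value: the simple ratio is
   negative off the segment, and the formula of [ratio_generic] can itself
   already be negative there, e.g. when P is beyond B. *)
Definition signed (A P B : Sol) (r : R) : R :=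
  if excluded_middle_informative (between A P B) then r else - Rabs r.

(* theta A P = theta A B when P and B are on the same side of A, and
   theta A P = - theta A B otherwise. *)
Definition ratio_generic (A P B : Sol) : R :=
  let p := exp (- (tdist A P * sin (theta A P))) in
  let b := exp (- (tdist A B * sin (theta A B))) in
  signed A P B ((1 - p) / (p - b)).

Definition ratio_dist (A P B : Sol) : R :=
  signed A P B (tdist A P / tdist P B).

(* An isometry fixing the origin and exchanging the [x,z] and [y,z] planes; the
   three other ones differ from it by signs of x and y, on which
   [ratio_generic origin] does not depend. *)
Definition swap (X : Sol) : Sol := mkSol (py X) (px X) (- pz X).

Definition simple_ratio0 (P B : Sol) : R :=
  let g := gcurve origin B in
  if excluded_middle_informative (in_xy g \/ in_z_axis g)
  then ratio_dist origin P B
  else if excluded_middle_informative (in_yz g)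
  then ratio_generic origin (swap P) (swap B)
  else ratio_generic origin P B.

Definition simple_ratio (A P B : Sol) : R :=
  simple_ratio0 (untrans A P) (untrans A B).

Definition translation_triangle (A0 A1 A2 : Sol) : Prop :=
  ~ exists C f t, params f t /\ on_curve C f t A0 /\ on_curve C f t A1 /\ on_curve C f t A2.

(* The image of (cos theta cos phi, cos theta sin phi, sin theta) under the
   differential at the origin of the translation by P; a tangent vector is
   recorded by its three coordinates. *)
Definition tangent (P A : Sol) : R * R * R :=
  let f := phi P A in
  let t := theta P A in
  (exp (- pz P) * (cos t * cos f), exp (pz P) * (cos t * sin f), sin t).

Definition dot (u v : R * R * R) : R :=
  let '(u1, u2, u3) := u in
  let '(v1, v2, v3) := v in u1 * v1 + u2 * v2 + u3 * v3.

Definition coplanar (u v w : R * R * R) : Prop :=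
  exists n : R * R * R, n <> (0, 0, 0) /\ dot n u = 0 /\ dot n v = 0 /\ dot n w = 0.

Definition surface (A0 A1 A2 P : Sol) : Prop :=
  P = A0 \/ P = A1 \/ P = A2 \/
  coplanar (tangent P A0) (tangent P A1) (tangent P A2).

Definition proj (P : Sol) : R * R := (px P, pz P).

Definition mmap (u : R * R) : R * R := (fst u, exp (- snd u)).

Definition eline (U V W : R * R) : Prop :=
  exists s : R, W = (fst U + s * (fst V - fst U), snd U + s * (snd V - snd U)).

Definition in_vertical_plane (A1 A2 : Sol) : Prop :=
  (px A1 = 0 /\ px A2 = 0) \/ (py A1 = 0 /\ py A2 = 0).

(* The vertex A0 is the origin here. *)
Definition connecting_curve0 (A1 A2 P1 P2 X : Sol) : Prop :=
  (in_vertical_plane A1 A2 /\ gcurve P1 P2 X) \/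
  (~ in_vertical_plane A1 A2 /\ proj P1 <> proj P2 /\
     surface origin A1 A2 X /\
     eline (mmap (proj P1)) (mmap (proj P2)) (mmap (proj X))) \/
  (~ in_vertical_plane A1 A2 /\ proj P1 = proj P2 /\
     surface origin A1 A2 X /\ px X = px P1).

Definition connecting_curve (A0 A1 A2 P1 P2 X : Sol) : Prop :=
  connecting_curve0 (untrans A0 A1) (untrans A0 A2)
    (untrans A0 P1) (untrans A0 P2) (untrans A0 X).

Definition surface_line (A0 A1 A2 : Sol) (l : Sol -> Prop) : Prop :=
  exists P1 P2 : Sol, P1 <> P2 /\ surface A0 A1 A2 P1 /\ surface A0 A1 A2 P2 /\
    forall X, l X <-> connecting_curve A0 A1 A2 P1 P2 X.

(* The curve g_AB after the translation carrying A to the origin. *)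
Definition side (A B : Sol) : Sol -> Prop := gcurve origin (untrans A B).

(* On a curve parallel to the z-axis [simple_ratio] is a ratio of differences of
   z, in a plane parallel to [y,z] it is a ratio of differences of e^z, and
   elsewhere one of differences of e^(-z). Their product is not -1 when these
   normalizations are mixed, e.g. for the vertices (0,0,0), (0,0,1), (1,0,0) or
   (0,0,0), (0,1,1), (1,0,0). *)
Definition compatible_sides (A0 A1 A2 : Sol) : Prop :=
  let s1 := side A0 A1 in
  let s2 := side A1 A2 in
  let s3 := side A2 A0 in
  (~ in_z_axis s1 /\ ~ in_z_axis s2 /\ ~ in_z_axis s3) /\
  ((in_yz s1 /\ in_yz s2 /\ in_yz s3) \/
   ((in_yz s1 -> in_xy s1) /\ (in_yz s2 -> in_xy s2) /\ (in_yz s3 -> in_xy s3))).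

(* Main.v *)
Require Import Defs.
From Stdlib Require Import Reals Lra ClassicalEpsilon.
Open Scope R_scope.

(** Along a translation curve [x] is affine in [exp (- z)] and [y] is affine in
    [exp z], so [y * exp (- z)] is again affine in [exp (- z)].  Hence in the
    chart [(x, y * exp (- z), exp (- z))], which identifies Sol with an open
    half-space of Euclidean space, translation curves are exactly the straight
    lines, restricted to the half-space ([gcurve_divides]), translations
    are affine maps ([divides_untrans]), and the surface of a triangle lies in
    the plane of its vertices.  The theorem is Menelaus' theorem in this chart.

    Whatever the type of the connecting curve [l], there is a function [F],
    affine in the chart, that vanishes on [l] and at no vertex
    ([surface_line_equation]): [l] is cut out of the surface by the plane
    [F = 0], and the vertices are on the surface but not on [l].  If [F]
    vanishes at [X] on the line [AB], then affinity of [F] forces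
    [X] to divide [A], [B] in the ratio [- F A / F B] ([divides_zero]).  The
    product of three such ratios around the triangle telescopes to [-1].

    It remains to compare [simple_ratio] with the affine ratio in the chart.
    They agree, except on sides parallel to the [y,z] plane: there [swap]
    replaces the height [exp (- z)] by its inverse, which in the
    chart is a projective map.  It multiplies the affine ratio of [A], [X],
    [B] by [height B / height A] ([simple_ratio_divides_yz]), a factor which
    telescopes as well when it occurs on all three sides. *)

(** * The affine chart *)

Definition height (X : Sol) : R := exp (- pz X).

Lemma height_pos (X : Sol) : 0 < height X.
Proof. apply exp_pos. Qed.

Lemma exp_mul_opp (z : R) : exp z * exp (- z) = 1.
Proof. rewrite <- exp_plus, Rplus_opp_r. apply exp_0. Qed.

Lemma chart_injective (X Y : Sol) :
  px X = px Y -> py X * height X = py Y * height Y -> height X = height Y -> X = Y.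
Proof.
  intros Hx Hq Hh.
  assert (Hy : py X = py Y).
  { rewrite Hh in Hq. apply Rmult_eq_reg_r in Hq; [exact Hq|].
    pose proof (height_pos Y); lra. }
  assert (Hz : pz X = pz Y) by (apply exp_inv in Hh; lra).
  destruct X, Y; simpl in *; subst; reflexivity.
Qed.

(** [X] is the point [(1 - s) A + s B] in the chart. *)
Definition divides (s : R) (A B X : Sol) : Prop :=
  px X = (1 - s) * px A + s * px B /\
  py X * height X = (1 - s) * (py A * height A) + s * (py B * height B) /\
  height X = (1 - s) * height A + s * height B.

Lemma divides_sym (s : R) (A B X : Sol) : divides s A B X -> divides (1 - s) B A X.
Proof. intros (Hx & Hq & Hh); repeat split; lra. Qed.

Lemma divides_unique (s r : R) (A B X : Sol) :
  A <> B -> divides s A B X -> divides r A B X -> s = r.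
Proof.
  intros HAB (Hx & Hq & Hh) (Hx' & Hq' & Hh').
  destruct (Req_dec s r) as [E | E]; [exact E|].
  exfalso; apply HAB; apply chart_injective; apply (Rmult_eq_reg_l (s - r)); lra.
Qed.

Lemma divides_untrans (G : Sol) (s : R) (A B X : Sol) :
  divides s A B X -> divides s (untrans G A) (untrans G B) (untrans G X).
Proof.
  intros (Hx & Hq & Hh).
  assert (Hu : forall Y, height (untrans G Y) = height Y * exp (pz G)).
  { intro Y; unfold height, untrans; simpl. rewrite <- exp_plus. f_equal; ring. }
  assert (Hv : forall Y, py (untrans G Y) * height (untrans G Y)
                         = py Y * height Y - py G * height Y).
  { intro Y; rewrite Hu; unfold untrans; simpl.
    transitivity ((py Y - py G) * height Y * (exp (pz G) * exp (- pz G))); [ring|].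
    rewrite exp_mul_opp; ring. }
  repeat split; rewrite ?Hv, ?Hu.
  - unfold untrans; simpl; rewrite Hx; ring.
  - rewrite Hq, Hh; ring.
  - rewrite Hh; ring.
Qed.

(** In the chart [swap] is [(x, q, h) |-> (q / h, x / h, 1 / h)], a projective
    map: it keeps lines and rescales the weights of [A] and [B] by their heights. *)
Lemma divides_swap (s : R) (A B X : Sol) :
  divides s A B X ->
  divides (s * height B / height X) (swap A) (swap B) (swap X).
Proof.
  intros (Hx & Hq & Hh).
  assert (Hs : forall Y, height (swap Y) = / height Y).
  { intro Y; unfold height, swap; simpl. rewrite <- exp_Ropp. reflexivity. }
  pose proof (height_pos A); pose proof (height_pos B); pose proof (height_pos X).
  assert (Hc : 1 - s * height B / height X = (1 - s) * height A / height X).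
  { apply (Rmult_eq_reg_r (height X)); [|lra]. field_simplify; lra. }
  unfold divides; rewrite !Hc, !Hs; unfold swap; simpl; repeat split;
    apply (Rmult_eq_reg_r (height X)); try lra; field_simplify; lra.
Qed.

(** * Translation curves are the lines of the chart *)

(** The affine parameter along a curve: in the chart, [curve0 f a t] is
    [(0, 0, 1)] plus [chord a t] times
    [(cos a * cos f, cos a * sin f, - sin a)], whether or not [a] is zero. *)
Definition chord (a t : R) : R :=
  if Req_dec_T a 0 then t else (1 - exp (- (t * sin a))) / sin a.

Lemma sin_direction_neq0 (a : R) : - (PI / 2) <= a <= PI / 2 -> a <> 0 -> sin a <> 0.
Proof.
  intros Ha H0. pose proof PI_RGT_0.
  destruct (Rlt_le_dec 0 a).
  - assert (0 < sin a) by (apply sin_gt_0; lra). lra.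
  - assert (0 < sin (- a)) by (apply sin_gt_0; lra). rewrite sin_neg in *; lra.
Qed.

Lemma chord_0 (a : R) : chord a 0 = 0.
Proof.
  unfold chord; destruct (Req_dec_T a 0); [reflexivity|].
  rewrite Rmult_0_l, Ropp_0, exp_0. unfold Rdiv; ring.
Qed.

Lemma chord_increasing (a t u : R) :
  - (PI / 2) <= a <= PI / 2 -> t < u -> chord a t < chord a u.
Proof.
  intros Ha Htu. unfold chord; destruct (Req_dec_T a 0) as [|H0]; [exact Htu|].
  pose proof (sin_direction_neq0 a Ha H0).
  assert (E : (1 - exp (- (u * sin a))) / sin a - (1 - exp (- (t * sin a))) / sin a
              = (exp (- (t * sin a)) - exp (- (u * sin a))) / sin a) by (field; auto).
  destruct (Rlt_le_dec 0 (sin a)).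
  - assert (exp (- (u * sin a)) < exp (- (t * sin a))) by (apply exp_increasing; nra).
    assert (0 < (exp (- (t * sin a)) - exp (- (u * sin a))) / sin a)
      by (apply Rdiv_lt_0_compat; lra).
    lra.
  - assert (exp (- (t * sin a)) < exp (- (u * sin a))) by (apply exp_increasing; nra).
    assert (0 < (exp (- (u * sin a)) - exp (- (t * sin a))) / (- sin a))
      by (apply Rdiv_lt_0_compat; lra).
    replace ((exp (- (t * sin a)) - exp (- (u * sin a))) / sin a)
      with ((exp (- (u * sin a)) - exp (- (t * sin a))) / (- sin a)) in E by (field; auto).
    lra.
Qed.

Lemma chord_lt_inv (a t u : R) :
  - (PI / 2) <= a <= PI / 2 -> chord a t < chord a u -> t < u.
Proof.
  intros Ha H. destruct (Rtotal_order t u) as [|[E|L]]; [assumption| |].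
  - subst; lra.
  - apply (chord_increasing a) in L; [lra|exact Ha].
Qed.

Lemma chord_onto (a c : R) :
  - (PI / 2) <= a <= PI / 2 -> 0 < 1 - c * sin a -> exists t, chord a t = c.
Proof.
  intros Ha Hc. unfold chord; destruct (Req_dec_T a 0) as [|H0]; [now exists c|].
  pose proof (sin_direction_neq0 a Ha H0).
  exists (- ln (1 - c * sin a) / sin a).
  replace (- (- ln (1 - c * sin a) / sin a * sin a)) with (ln (1 - c * sin a))
    by (field; auto).
  rewrite exp_ln by exact Hc. field; auto.
Qed.

(** Apart from [height A], the right-hand sides are affine in [chord a t], which
    is why the curve is a line of the chart. *)
Lemma curve_chart (A : Sol) (f a t : R) (X : Sol) :
  params f a ->
  (X = curve A f a t <->
   px X - px A = height A * (chord a t * (cos a * cos f)) /\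
   (py X - py A) * height X = chord a t * (cos a * sin f) /\
   height X = height A * (1 - chord a t * sin a)).
Proof.
  intros [_ Ha].
  assert (H : forall Y, Y = curve A f a t ->
   px Y - px A = height A * (chord a t * (cos a * cos f)) /\
   (py Y - py A) * height Y = chord a t * (cos a * sin f) /\
   height Y = height A * (1 - chord a t * sin a)).
  { intros Y ->. unfold curve, trans, curve0, chord, height.
    destruct (Req_dec_T a 0) as [->|H0]; simpl.
    - rewrite cos_0, sin_0, Rplus_0_r. repeat split; try ring.
      transitivity (t * sin f * (exp (pz A) * exp (- pz A))); [ring|].
      rewrite exp_mul_opp; ring.
    - pose proof (sin_direction_neq0 a Ha H0).
      rewrite (Ropp_plus_distr (pz A)), exp_plus. repeat split; try (field; auto).
      transitivity (cos a / sin a * sin f *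
        (exp (t * sin a) * exp (- (t * sin a)) - exp (- (t * sin a)))
        * (exp (pz A) * exp (- pz A))); [ring|].
      rewrite !exp_mul_opp. field; auto. }
  split; [apply H|].
  intros (Hx & Hq & Hh). destruct (H _ eq_refl) as (Hx' & Hq' & Hh').
  apply chart_injective; try lra.
  rewrite <- Hh' in Hh. rewrite Hh in *. lra.
Qed.

(** * The translation curve joining two points *)

Lemma polar_plane (u v : R) :
  exists f, - PI < f <= PI /\
    u = sqrt (u * u + v * v) * cos f /\ v = sqrt (u * u + v * v) * sin f.
Proof.
  pose proof PI_RGT_0. set (r := sqrt (u * u + v * v)).
  assert (Hr0 : 0 <= r) by apply sqrt_pos.
  assert (Hr2 : r * r = u * u + v * v) by (apply sqrt_sqrt; nra).
  destruct (Req_dec r 0) as [E|E].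
  - exists 0. rewrite E in *. repeat split; try lra; nra.
  - assert (Hc : -1 <= u / r <= 1).
    { split; apply (Rmult_le_reg_r r); try lra; unfold Rdiv;
        rewrite Rmult_assoc, Rinv_l by lra; nra. }
    assert (Hs : sqrt (1 - (u / r)²) = Rabs v / r).
    { apply sqrt_lem_1.
      - unfold Rsqr; nra.
      - apply Rle_mult_inv_pos; [apply Rabs_pos|lra].
      - transitivity (Rabs v * Rabs v / (r * r)); [field; lra|].
        replace (Rabs v * Rabs v) with (v * v).
        + replace (v * v) with (r * r - u * u) by lra. unfold Rsqr. field; lra.
        + symmetry; apply (eq_sym (Rsqr_abs v)). }
    pose proof (acos_bound (u / r)) as Hb.
    destruct (Rle_lt_dec 0 v) as [Hv|Hv].
    + exists (acos (u / r)). rewrite cos_acos, sin_acos by exact Hc.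
      rewrite Hs, Rabs_right by lra. repeat split; try lra; field; lra.
    + exists (- acos (u / r)). rewrite cos_neg, sin_neg, cos_acos, sin_acos by exact Hc.
      rewrite Hs, Rabs_left by lra. repeat split; try lra; try (field; lra).
      destruct (Req_dec (acos (u / r)) PI) as [Hp|Hp]; [|lra].
      exfalso. apply (f_equal cos) in Hp. rewrite cos_acos, cos_PI in Hp by exact Hc.
      assert (u = - r) by (replace u with (u / r * r) by (field; lra); rewrite Hp; ring).
      nra.
Qed.

(** The latitude [a] comes from polar coordinates of the vector [(r, w)], where
    [r >= 0] is the length of [(u, v)]; that sign confines [a] to the right
    half-circle. *)
Lemma polar_space (u v w : R) :
  exists f a N, params f a /\ 0 <= N /\
    u = N * (cos a * cos f) /\ v = N * (cos a * sin f) /\ w = N * sin a.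
Proof.
  pose proof PI_RGT_0. set (r := sqrt (u * u + v * v)).
  destruct (polar_plane u v) as (f & Hf & Hu & Hv). fold r in Hu, Hv.
  destruct (polar_plane r w) as (a & Ha & Hr & Hw).
  set (N := sqrt (r * r + w * w)) in *.
  assert (Hr0 : 0 <= r) by apply sqrt_pos.
  assert (HN0 : 0 <= N) by apply sqrt_pos.
  destruct (Req_dec N 0) as [E|E].
  - exists f, 0, 0. unfold params. rewrite E in *.
    assert (r = 0) by lra. repeat split; try lra; rewrite ?Hu, ?Hv; nra.
  - exists f, a, N. unfold params. repeat split; try lra.
    + destruct (Rle_lt_dec (- (PI / 2)) a); [assumption|exfalso].
      assert (cos (- a) < 0) by (apply cos_lt_0; lra). rewrite cos_neg in *; nra.
    + destruct (Rle_lt_dec a (PI / 2)); [assumption|exfalso].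
      assert (cos a < 0) by (apply cos_lt_0; lra). nra.
    + rewrite Hu at 1. rewrite Hr. ring.
    + rewrite Hv at 1. rewrite Hr. ring.
Qed.

(** The chart turns the search for a curve into spherical coordinates of the
    difference of [B] and [A]; [chord_onto] applies because heights are
    positive.  For [A = B] the length [N] is zero, and so is the time. *)
Lemma connect_reaches (A B : Sol) : reaches A B (connect A B).
Proof.
  unfold connect; apply epsilon_spec.
  pose proof (height_pos A); pose proof (height_pos B).
  destruct (polar_space ((px B - px A) / height A) ((py B - py A) * height B)
              (1 - height B / height A)) as (f & a & N & Hp & HN & Hu & Hv & Hw).
  destruct (chord_onto a N) as [t Ht]; [apply Hp| |].
  { rewrite <- Hw. assert (0 < height B / height A) by (apply Rdiv_lt_0_compat; lra). lra. }
  exists (f, a, t). split; [exact Hp|split].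
  - destruct (Rle_lt_dec 0 t) as [|L]; [assumption|].
    apply (chord_increasing a) in L; [|apply Hp]. rewrite chord_0 in L. lra.
  - symmetry. apply curve_chart; [exact Hp|]. rewrite Ht, <- Hu, <- Hv, <- Hw.
    repeat split; field; lra.
Qed.

Lemma connect_spec (A B : Sol) :
  params (phi A B) (theta A B) /\ 0 <= tdist A B /\
  B = curve A (phi A B) (theta A B) (tdist A B).
Proof.
  pose proof (connect_reaches A B) as H. unfold phi, theta, tdist.
  destruct (connect A B) as [[f a] t]; simpl in *. intuition.
Qed.

Lemma tdist_sin_theta (A B : Sol) : tdist A B * sin (theta A B) = pz B - pz A.
Proof.
  destruct (connect_spec A B) as (_ & _ & H). apply (f_equal pz) in H.
  unfold curve, trans, curve0 in H.
  destruct (Req_dec_T (theta A B) 0) as [E|E]; simpl in H; [|lra].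
  rewrite E, sin_0; lra.
Qed.

Lemma connect_chord_pos (A B : Sol) :
  A <> B -> 0 < chord (theta A B) (tdist A B).
Proof.
  intro HAB. destruct (connect_spec A B) as (Hp & HT & HB).
  rewrite <- (chord_0 (theta A B)). apply chord_increasing; [apply Hp|].
  destruct HT as [HT|HT]; [exact HT|exfalso; apply HAB].
  rewrite <- HT in HB. apply (curve_chart _ _ _ _ _ Hp) in HB. rewrite chord_0 in HB.
  destruct HB as (Hx & Hq & Hh). assert (E : height A = height B) by lra.
  apply chart_injective; try lra. rewrite E. lra.
Qed.

(** Both [X] and [B] are displaced from [A] along one fixed direction of the
    chart, by amounts proportional to their chords. *)
Lemma curve_divides (A B X : Sol) (t : R) :
  A <> B ->
  (X = curve A (phi A B) (theta A B) t <->
   divides (chord (theta A B) t / chord (theta A B) (tdist A B)) A B X).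
Proof.
  intro HAB. pose proof (connect_chord_pos A B HAB) as HC.
  destruct (connect_spec A B) as (Hp & _ & HB).
  apply (curve_chart _ _ _ _ _ Hp) in HB.
  rewrite (curve_chart _ _ _ _ _ Hp). unfold divides.
  set (C := chord (theta A B) (tdist A B)) in *. set (c := chord (theta A B) t).
  assert (Hc : c = c / C * C) by (field; lra).
  set (s := c / C) in *. clearbody s. rewrite Hc. clear Hc. clearbody c C.
  set (u := cos (theta A B) * cos (phi A B)) in *.
  set (v := cos (theta A B) * sin (phi A B)) in *.
  set (w := sin (theta A B)) in *. clearbody u v w.
  destruct HB as (Hx & Hq & Hh).
  assert (HqB : py B * height B = py A * height B + C * v) by lra.
  assert (HxB : px B = px A + height A * (C * u)) by lra.
  rewrite HqB, HxB, Hh.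
  split; intros (Hx' & Hq' & Hh'); repeat split; try lra.
  - transitivity (py A * height X + s * C * v); [lra|]. rewrite Hh'. ring.
  - transitivity (py X * height X - py A * height X); [ring|]. rewrite Hq', Hh'. ring.
Qed.

Lemma divides_curve (s : R) (A B X : Sol) :
  A <> B -> divides s A B X ->
  exists t, X = curve A (phi A B) (theta A B) t /\
    chord (theta A B) t = s * chord (theta A B) (tdist A B).
Proof.
  intros HAB HX. pose proof (connect_chord_pos A B HAB) as HC.
  destruct (connect_spec A B) as (Hp & _ & HB).
  apply (curve_chart _ _ _ _ _ Hp) in HB. destruct HB as (_ & _ & Hh).
  pose proof (height_pos A); pose proof (height_pos X).
  destruct (chord_onto (theta A B) (s * chord (theta A B) (tdist A B))) as [t Ht];
    [apply Hp| |].
  - destruct HX as (_ & _ & HX). rewrite Hh in HX.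
    apply (Rmult_lt_reg_l (height A)); [assumption|]. lra.
  - exists t. split; [|exact Ht]. apply curve_divides; [exact HAB|].
    rewrite Ht. replace (s * _ / _) with s by (field; lra). exact HX.
Qed.

Lemma gcurve_divides (A B X : Sol) :
  A <> B -> (gcurve A B X <-> exists s, divides s A B X).
Proof.
  intro HAB. split.
  - intros [t Ht]. apply (curve_divides A B X t HAB) in Ht. eexists; exact Ht.
  - intros [s Hs]. destruct (divides_curve s A B X HAB Hs) as (t & Ht & _).
    exists t; exact Ht.
Qed.

(** * Simple ratios as affine ratios *)

Lemma between_divides (s : R) (A B X : Sol) :
  A <> B -> divides s A B X -> (between A X B <-> 0 < s < 1).
Proof.
  intros HAB HX. pose proof (connect_chord_pos A B HAB) as HC.
  destruct (connect_spec A B) as ((_ & Ha) & _ & _).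
  destruct (divides_curve s A B X HAB HX) as (t & Ht & Hc).
  split.
  - intros (u & Hu & Hcu).
    apply (curve_divides A B X u HAB) in Hcu.
    rewrite (divides_unique _ _ _ _ _ HAB HX Hcu).
    destruct Hu as [Hu0 HuT].
    apply (chord_increasing _ _ _ Ha) in Hu0. apply (chord_increasing _ _ _ Ha) in HuT.
    rewrite chord_0 in Hu0. split.
    + apply Rdiv_lt_0_compat; lra.
    + apply (Rmult_lt_reg_r (chord (theta A B) (tdist A B))); [exact HC|].
      unfold Rdiv; rewrite Rmult_assoc, Rinv_l; lra.
  - intros Hs. exists t. split; [|exact Ht].
    split; apply (chord_lt_inv _ _ _ Ha); rewrite ?chord_0, Hc; nra.
Qed.

(** [s / (1 - s)] is positive exactly on the segment, so the sign convention of
    [signed] restores it from its absolute value. *)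
Lemma signed_divides (s r : R) (A B X : Sol) :
  A <> B -> divides s A B X -> s <> 0 -> s <> 1 ->
  r = s / (1 - s) \/ r = Rabs (s / (1 - s)) ->
  signed A X B r = s / (1 - s).
Proof.
  intros HAB HX H0 H1 Hr. unfold signed.
  destruct (excluded_middle_informative _) as [Hb|Hb];
    rewrite (between_divides s A B X HAB HX) in Hb.
  - assert (0 < s / (1 - s)) by (apply Rdiv_lt_0_compat; lra).
    rewrite Rabs_right in Hr; lra.
  - assert (s / (1 - s) <= 0).
    { destruct (Rlt_le_dec s 0).
      - replace (s / (1 - s)) with (- (- s / (1 - s))) by (field; lra).
        assert (0 < - s / (1 - s)) by (apply Rdiv_lt_0_compat; lra). lra.
      - replace (s / (1 - s)) with (- (s / (s - 1))) by (field; lra).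
        assert (0 < s / (s - 1)) by (apply Rdiv_lt_0_compat; lra). lra. }
    destruct Hr as [-> | ->]; rewrite ?Rabs_Rabsolu, Rabs_left1; lra.
Qed.

Lemma height_origin : height origin = 1.
Proof. unfold height, origin; simpl. rewrite Ropp_0. apply exp_0. Qed.

(** The formula is the ratio of differences of heights, one of the affine
    coordinates; [pz B <> 0] makes that coordinate nonconstant. *)
Lemma ratio_generic_divides (s : R) (B X : Sol) :
  pz B <> 0 -> divides s origin B X -> s <> 0 -> s <> 1 ->
  ratio_generic origin X B = s / (1 - s).
Proof.
  intros HB HX H0 H1.
  assert (HAB : origin <> B) by (intros <-; apply HB; reflexivity).
  unfold ratio_generic. apply (signed_divides s); auto. left.
  rewrite !tdist_sin_theta. unfold origin; simpl; rewrite !Rminus_0_r.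
  destruct HX as (_ & _ & Hh). rewrite height_origin in Hh.
  change (exp (- pz X)) with (height X). change (exp (- pz B)) with (height B).
  assert (Hne : height B <> 1).
  { unfold height; rewrite <- exp_0; intro E; apply exp_inv in E; lra. }
  rewrite Hh. field. split; [lra|].
  intro E. apply (Rmult_integral_contrapositive_currified (1 - s) (1 - height B)); lra.
Qed.

(** At height 1 translations act as Euclidean ones, and translation curves with
    [theta = 0] are Euclidean lines with unit speed. *)
Lemma tdist_horizontal (A B : Sol) :
  pz A = 0 -> pz B = 0 ->
  tdist A B = sqrt ((px B - px A)² + (py B - py A)²).
Proof.
  intros HA HB. destruct (connect_spec A B) as (Hp & HT & H).
  pose proof (tdist_sin_theta A B) as Hs. rewrite HA, HB, Rminus_0_r in Hs.
  symmetry; apply sqrt_lem_1; [apply Rplus_le_le_0_compat; apply Rle_0_sqr|exact HT|].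
  apply Rmult_integral in Hs. destruct Hs as [Hs|Hs].
  - apply (curve_chart _ _ _ _ _ Hp) in H. rewrite Hs, chord_0 in *.
    destruct H as (Hx & Hq & _). rewrite !Rmult_0_l, Rmult_0_r in *.
    pose proof (height_pos B). rewrite Hx.
    apply Rmult_integral in Hq. destruct Hq as [Hq|]; [rewrite Hq; unfold Rsqr; ring|lra].
  - assert (Ha : theta A B = 0).
    { destruct (Req_dec (theta A B) 0) as [|E]; [assumption|].
      apply sin_direction_neq0 in E; [contradiction|apply Hp]. }
    set (T := tdist A B) in *. set (f := phi A B) in *.
    rewrite Ha in H. unfold curve, trans, curve0 in H.
    destruct (Req_dec_T 0 0); [|lra]. rewrite H; simpl.
    rewrite HA, Ropp_0, exp_0.
    transitivity (T * T * ((sin f)² + (cos f)²)); [|unfold Rsqr; ring].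
    rewrite sin2_cos2; ring.
Qed.

Lemma ratio_dist_divides (s : R) (B X : Sol) :
  origin <> B -> pz B = 0 -> divides s origin B X -> s <> 0 -> s <> 1 ->
  ratio_dist origin X B = s / (1 - s).
Proof.
  intros HAB HB HX H0 H1. unfold ratio_dist.
  apply (signed_divides s); auto. right.
  destruct HX as (Hx & Hq & Hh).
  assert (HhB : height B = 1) by (unfold height; rewrite HB, Ropp_0; apply exp_0).
  rewrite height_origin, HhB in Hh.
  assert (HhX : height X = 1) by lra.
  assert (HzX : pz X = 0).
  { unfold height in HhX; rewrite <- exp_0 in HhX; apply exp_inv in HhX; lra. }
  rewrite HhX, HhB in Hq. simpl in Hx, Hq.
  rewrite !tdist_horizontal by (auto; reflexivity). simpl.
  assert (Hr : 0 < (px B)² + (py B)²).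
  { destruct (Rle_lt_dec ((px B)² + (py B)²) 0) as [L|]; [exfalso|assumption].
    pose proof (Rle_0_sqr (px B)); pose proof (Rle_0_sqr (py B)).
    assert (Ex : px B = 0) by (apply Rsqr_0_uniq; lra).
    assert (Ey : py B = 0) by (apply Rsqr_0_uniq; lra).
    apply HAB. apply chart_injective; rewrite ?Ex, ?Ey, ?height_origin; simpl; lra. }
  replace ((px X - 0)² + (py X - 0)²) with (s² * ((px B)² + (py B)²))
    by (rewrite Hx; replace (py X) with (s * py B) by lra; unfold Rsqr; ring).
  replace ((px B - px X)² + (py B - py X)²) with ((1 - s)² * ((px B)² + (py B)²))
    by (rewrite Hx; replace (py X) with (s * py B) by lra; unfold Rsqr; ring).
  rewrite !sqrt_mult by (apply Rle_0_sqr || lra). rewrite !sqrt_Rsqr_abs.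
  unfold Rdiv at 2; rewrite Rabs_mult, Rabs_inv.
  assert (0 < sqrt ((px B)² + (py B)²)) by (apply sqrt_lt_R0; exact Hr).
  assert (Rabs (1 - s) <> 0) by (apply Rabs_no_R0; lra).
  field. split; [assumption|]. lra.
Qed.

Lemma untrans_self (A : Sol) : untrans A A = origin.
Proof. unfold untrans, origin. f_equal; ring. Qed.

Lemma untrans_injective (G X Y : Sol) : untrans G X = untrans G Y -> X = Y.
Proof. intro E. rewrite <- (trans_untrans G X), E. apply trans_untrans. Qed.

Lemma untrans_neq_origin (A B : Sol) : A <> B -> origin <> untrans A B.
Proof.
  intro HAB. rewrite <- (untrans_self A). intro E; apply HAB, (untrans_injective A), E.
Qed.

Lemma side_in_xy (A B : Sol) : A <> B -> (in_xy (side A B) <-> pz B = pz A).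
Proof.
  intro HAB.
  pose proof (untrans_neq_origin A B HAB) as HO.
  assert (HB : pz (untrans A B) = pz B - pz A) by reflexivity.
  split.
  - intro H. assert (pz (untrans A B) = 0); [|lra]. apply H.
    apply gcurve_divides; [exact HO|]. exists 1. repeat split; ring.
  - intros E X HX. apply gcurve_divides in HX; [|exact HO].
    destruct HX as (s & _ & _ & Hh). rewrite height_origin in Hh.
    unfold height in Hh. replace (pz (untrans A B)) with 0 in Hh by lra.
    rewrite Ropp_0, exp_0 in Hh.
    assert (Hh' : exp (- pz X) = exp 0) by (rewrite exp_0; lra).
    apply exp_inv in Hh'; lra.
Qed.

Lemma simple_ratio_divides (s : R) (A B X : Sol) :
  A <> B -> divides s A B X -> s <> 0 -> s <> 1 ->
  ~ in_z_axis (side A B) ->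
  (in_yz (side A B) -> in_xy (side A B)) ->
  simple_ratio A X B = s / (1 - s).
Proof.
  intros HAB HX H0 H1 Hz Hyz.
  pose proof (side_in_xy A B HAB) as Hxy.
  pose proof (untrans_neq_origin A B HAB) as HO.
  apply (divides_untrans A) in HX. rewrite untrans_self in HX.
  unfold simple_ratio, simple_ratio0. fold (side A B).
  destruct (excluded_middle_informative _) as [[E|E]|E]; [|contradiction|].
  - apply ratio_dist_divides; auto. simpl. apply Hxy in E; lra.
  - destruct (excluded_middle_informative _) as [F|F]; [tauto|].
    apply ratio_generic_divides; auto. simpl. intro F'. apply E; left; apply Hxy; lra.
Qed.

(** The extra factor is the effect of [divides_swap]; on a horizontal side,
    where no swap occurs, it is 1. *)
Lemma simple_ratio_divides_yz (s : R) (A B X : Sol) :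
  A <> B -> divides s A B X -> s <> 0 -> s <> 1 ->
  ~ in_z_axis (side A B) -> in_yz (side A B) ->
  simple_ratio A X B = s * height B / ((1 - s) * height A).
Proof.
  intros HAB HX H0 H1 Hz Hyz.
  pose proof (side_in_xy A B HAB) as Hxy.
  pose proof (height_pos A); pose proof (height_pos B); pose proof (height_pos X).
  destruct (excluded_middle_informative (in_xy (side A B))) as [E|E].
  - rewrite (simple_ratio_divides s) by auto.
    apply Hxy in E. unfold height. rewrite E. field. split; [|lra].
    apply Rgt_not_eq, exp_pos.
  - remember (s * height B / height X) as r eqn:Hr.
    assert (Hr1 : 1 - r = (1 - s) * height A / height X).
    { destruct HX as (_ & _ & Hh). rewrite Hr.
      apply (Rmult_eq_reg_r (height X)); [|lra]. field_simplify; lra. }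
    replace (s * height B / ((1 - s) * height A)) with (r / (1 - r))
      by (rewrite Hr1, Hr; field; repeat split; lra).
    assert (Hr0 : r <> 0).
    { rewrite Hr. unfold Rdiv. repeat apply Rmult_integral_contrapositive_currified;
        try apply Rinv_neq_0_compat; lra. }
    assert (Hr1' : 1 - r <> 0).
    { rewrite Hr1. unfold Rdiv. repeat apply Rmult_integral_contrapositive_currified;
        try apply Rinv_neq_0_compat; lra. }
    apply divides_swap in HX; rewrite <- Hr in HX.
    apply (divides_untrans (swap A)) in HX. rewrite untrans_self in HX.
    assert (Hsw : forall Y, untrans (swap A) (swap Y) = swap (untrans A Y)).
    { intro Y; unfold untrans, swap; simpl. rewrite Ropp_involutive. f_equal; ring. }
    rewrite !Hsw in HX.
    unfold simple_ratio, simple_ratio0. fold (side A B).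
    destruct (excluded_middle_informative _) as [F|F]; [tauto|].
    destruct (excluded_middle_informative _) as [G|G]; [|contradiction].
    apply ratio_generic_divides; auto; [|lra].
    simpl. intro F'. apply E, Hxy; lra.
Qed.

(** * The plane cutting the line out of the surface *)

Definition chart_affine (F : Sol -> R) : Prop :=
  forall s A B X, divides s A B X -> F X = (1 - s) * F A + s * F B.

Lemma chart_affine_untrans (G : Sol) (F : Sol -> R) :
  chart_affine F -> chart_affine (fun X => F (untrans G X)).
Proof. intros HF s A B X HX. apply HF, divides_untrans, HX. Qed.

Lemma collinear_param (u1 v1 u2 v2 u v : R) :
  u1 <> u2 \/ v1 <> v2 ->
  (u - u1) * (v2 - v1) = (v - v1) * (u2 - u1) ->
  exists s, u = (1 - s) * u1 + s * u2 /\ v = (1 - s) * v1 + s * v2.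
Proof.
  intros Hne H. destruct (Req_dec u1 u2) as [E|E].
  - destruct Hne as [|Hv]; [contradiction|]. subst u2.
    exists ((v - v1) / (v2 - v1)). split; [|field; lra].
    assert (u - u1 = 0) by (apply (Rmult_eq_reg_r (v2 - v1)); lra). lra.
  - exists ((u - u1) / (u2 - u1)). split; [field; lra|].
    assert (Hv : v - v1 = (u - u1) * (v2 - v1) / (u2 - u1)) by (rewrite H; field; lra).
    replace v with (v1 + (v - v1)) by ring. rewrite Hv. field; lra.
Qed.

(** Inside a plane [x = const] or [y = const] two of the three chart coordinates
    determine a point, so one determinant detects collinearity. *)
Lemma divides_of_plane (A B X : Sol) :
  A <> B ->
  (px A = px B /\ px A = px X /\
   (py X * height X - py A * height A) * (height B - height A)
   = (height X - height A) * (py B * height B - py A * height A)) \/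
  (py A = py B /\ py A = py X /\
   (px X - px A) * (height B - height A) = (height X - height A) * (px B - px A)) ->
  exists s, divides s A B X.
Proof.
  intros HAB [(E1 & E2 & E)|(E1 & E2 & E)].
  - destruct (collinear_param (py A * height A) (height A) (py B * height B) (height B)
      (py X * height X) (height X)) as (s & Hu & Hv); [|exact E|].
    + destruct (Req_dec (height A) (height B)); [left|auto].
      intro; apply HAB, chart_injective; auto.
    + exists s. repeat split; auto. rewrite <- E1, <- E2. ring.
  - destruct (collinear_param (px A) (height A) (px B) (height B)
      (px X) (height X)) as (s & Hu & Hv); [|exact E|].
    + destruct (Req_dec (height A) (height B)) as [Eh|]; [left|auto].
      intro; apply HAB, chart_injective; auto. rewrite E1, Eh; reflexivity.
    + exists s. repeat split; auto. rewrite <- E1, <- E2, Hv. ring.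
Qed.

Lemma triangle_distinct (A0 A1 A2 : Sol) :
  translation_triangle A0 A1 A2 -> A0 <> A1 /\ A1 <> A2 /\ A0 <> A2.
Proof.
  intro H.
  assert (Hc : forall A B, on_curve A (phi A B) (theta A B) A /\
                           on_curve A (phi A B) (theta A B) B).
  { intros A B. destruct (connect_spec A B) as (Hp & _ & HB). split.
    - exists 0. apply curve_chart; [exact Hp|]. rewrite chord_0. repeat split; ring.
    - eexists; exact HB. }
  repeat split; intro E; subst; apply H.
  - exists A1, (phi A1 A2), (theta A1 A2). split; [apply connect_spec|].
    split; [|split]; apply Hc.
  - exists A0, (phi A0 A2), (theta A0 A2). split; [apply connect_spec|].
    split; [|split]; apply Hc.
  - exists A2, (phi A2 A1), (theta A2 A1). split; [apply connect_spec|].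
    split; [|split]; apply Hc.
Qed.

Lemma triangle_not_divides (A0 A1 A2 : Sol) :
  translation_triangle A0 A1 A2 -> ~ exists s, divides s A0 A1 A2.
Proof.
  intros H Hs. destruct (triangle_distinct _ _ _ H) as (H01 & _ & _).
  apply H. exists A0, (phi A0 A1), (theta A0 A1). split; [apply connect_spec|].
  split; [|split]; apply (gcurve_divides A0 A1); auto.
  - exists 0. repeat split; ring.
  - exists 1. repeat split; ring.
Qed.

(** Up to the factor [chord], the tangent at [P] of the curve to [A] is, after an
    invertible diagonal map, the difference of [A] and [P] with the middle
    coordinate [(py A - py P) * height A].  Multiplying by the chord rather than
    dividing by it also covers [P = A], where the tangent is arbitrary. *)
Lemma dot_tangent (n1 n2 n3 : R) (P A : Sol) :
  dot (n1, n2, n3) (tangent P A) = 0 ->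
  n1 * (px A - px P) + n2 * exp (pz P) * ((py A - py P) * height A)
  - n3 * exp (pz P) * (height A - height P) = 0.
Proof.
  intro H. destruct (connect_spec P A) as (Hp & _ & HA).
  apply (curve_chart _ _ _ _ _ Hp) in HA. destruct HA as (Hx & Hq & Hh).
  unfold dot, tangent in H. rewrite Hx, Hq, Hh.
  set (C := chord _ _) in *.
  transitivity (C * 0); [|ring]. rewrite <- H.
  assert (E : height P * exp (pz P) = 1)
    by (unfold height; rewrite Rmult_comm; apply exp_mul_opp).
  fold (height P).
  transitivity (C * (n1 * (height P * (cos (theta P A) * cos (phi P A)))
    + n2 * (exp (pz P) * (cos (theta P A) * sin (phi P A)))
    + n3 * ((height P * exp (pz P)) * sin (theta P A)))); [ring|].
  rewrite E. ring.
Qed.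

Lemma independent_rows (u1 v1 u2 v2 a b : R) :
  u1 * v2 <> u2 * v1 -> a * u1 + b * v1 = 0 -> a * u2 + b * v2 = 0 -> a = 0 /\ b = 0.
Proof.
  intros H H1 H2. split; apply (Rmult_eq_reg_r (u1 * v2 - u2 * v1)); try lra.
  - transitivity ((a * u1 + b * v1) * v2 - (a * u2 + b * v2) * v1); [ring|].
    rewrite H1, H2; ring.
  - transitivity ((a * u2 + b * v2) * u1 - (a * u1 + b * v1) * u2); [ring|].
    rewrite H1, H2; ring.
Qed.

(** The vector [n] normal to the three tangents at [P] is orthogonal to two
    independent vectors of the vertical plane containing the vertices.  So it is
    normal to that plane, and the plane through [P] that it defines contains the
    vertices only if it is that same plane. *)
Lemma surface_in_vertical_plane (A0 A1 A2 P : Sol) :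
  translation_triangle A0 A1 A2 -> surface A0 A1 A2 P ->
  (px A1 = px A0 -> px A2 = px A0 -> px P = px A0) /\
  (py A1 = py A0 -> py A2 = py A0 -> py P = py A0).
Proof.
  intros Htri [->|[->|[->|Hc]]]; [tauto|tauto|tauto|].
  destruct (triangle_distinct _ _ _ Htri) as (H01 & _ & _).
  pose proof (triangle_not_divides _ _ _ Htri) as Hnd.
  destruct Hc as (n & Hn & D0 & D1 & D2). destruct n as [[n1 n2] n3].
  apply dot_tangent in D0, D1, D2.
  pose proof (exp_pos (pz P)) as He. pose proof (height_pos P) as HhP.
  set (e := exp (pz P)) in *. clearbody e.
  split; intros E1 E2.
  - destruct (independent_rows (py A1 * height A1 - py A0 * height A0) (height A1 - height A0)
      (py A2 * height A2 - py A0 * height A0) (height A2 - height A0)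
      (n2 * e) (- (n3 * e) - n2 * e * py P)) as [F2 F3].
    + intro F. apply Hnd, divides_of_plane; [exact H01|left]. repeat split; lra.
    + rewrite E1 in D1. lra.
    + rewrite E2 in D2. lra.
    + rewrite F2, Rmult_0_l in F3.
      assert (n2 = 0) by (apply Rmult_integral in F2; lra).
      assert (n3 = 0) by (assert (F3' : n3 * e = 0) by lra; apply Rmult_integral in F3'; lra).
      subst n2 n3.
      assert (F : n1 * (px A0 - px P) = 0) by lra.
      apply Rmult_integral in F. destruct F as [F|F]; [|lra].
      subst; contradiction.
  - destruct (independent_rows (px A1 - px A0) (height A1 - height A0)
      (px A2 - px A0) (height A2 - height A0)
      n1 (n2 * e * (py A0 - py P) - n3 * e)) as [F1 F3].
    + intro F. apply Hnd, divides_of_plane; [exact H01|right]. repeat split; lra.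
    + rewrite E1 in D1. lra.
    + rewrite E2 in D2. lra.
    + assert (F : n3 * e * height P = 0).
      { transitivity (n1 * (px A0 - px P) + n2 * e * ((py A0 - py P) * height A0)
          - n3 * e * (height A0 - height P)
          - n1 * (px A0 - px P)
          - (n2 * e * (py A0 - py P) - n3 * e) * height A0); [ring|].
        rewrite D0, F1, F3; ring. }
      assert (n3 = 0).
      { apply Rmult_integral in F. destruct F as [F|]; [|lra].
        apply Rmult_integral in F. lra. }
      subst n3.
      assert (F' : n2 * e * (py A0 - py P) = 0) by lra.
      apply Rmult_integral in F'. destruct F' as [F'|]; [|lra].
      apply Rmult_integral in F'. destruct F' as [F'|]; [|lra].
      subst; contradiction.
Qed.

(** If the curve is defined by a cylinder or a plane, that is the equation to
    take.  If the vertices lie in a vertical plane, so do [P1] and [P2] by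
    [surface_in_vertical_plane]; the curve is the line [P1P2]
    of that plane, and the equation is that of the line in the plane. *)
Lemma surface_line_equation (A0 A1 A2 : Sol) (l : Sol -> Prop) :
  translation_triangle A0 A1 A2 -> surface_line A0 A1 A2 l ->
  ~ l A0 -> ~ l A1 -> ~ l A2 ->
  exists F, chart_affine F /\ (forall X, l X -> F X = 0) /\
    F A0 <> 0 /\ F A1 <> 0 /\ F A2 <> 0.
Proof.
  intros Htri (P1 & P2 & HP & HS1 & HS2 & Hl) H0 H1 H2.
  assert (HPu : untrans A0 P1 <> untrans A0 P2)
    by (intro E; apply HP, (untrans_injective A0), E).
  (* The vertices are on the surface, so there the equation of the cutting plane
     implies membership in l; hence F cannot vanish at a vertex. *)
  assert (Hequation : forall Z, chart_affine Z ->
    (forall X, l X -> Z (untrans A0 X) = 0) ->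
    (forall X, X = A0 \/ X = A1 \/ X = A2 -> Z (untrans A0 X) = 0 -> l X) ->
    exists F, chart_affine F /\ (forall X, l X -> F X = 0) /\
      F A0 <> 0 /\ F A1 <> 0 /\ F A2 <> 0).
  { intros Z HZ Hl' Hv. exists (fun X => Z (untrans A0 X)).
    split; [apply chart_affine_untrans, HZ|]. split; [exact Hl'|].
    repeat split; intro E; apply Hv in E; auto. }
  assert (Hsurf : forall X, X = A0 \/ X = A1 \/ X = A2 ->
    surface origin (untrans A0 A1) (untrans A0 A2) (untrans A0 X)).
  { intros X [->|[->| ->]]; unfold surface; rewrite ?untrans_self; auto. }
  unfold connecting_curve, connecting_curve0 in Hl.
  destruct (excluded_middle_informative
    (in_vertical_plane (untrans A0 A1) (untrans A0 A2))) as [V|V].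
  - destruct (surface_in_vertical_plane _ _ _ _ Htri HS1) as [Sx1 Sy1].
    destruct (surface_in_vertical_plane _ _ _ _ Htri HS2) as [Sx2 Sy2].
    assert (Hl' : forall X, l X <->
      exists s, divides s (untrans A0 P1) (untrans A0 P2) (untrans A0 X)).
    { intro X. rewrite Hl, <- gcurve_divides by exact HPu. tauto. }
    pose proof (exp_pos (pz A0)). pose proof (exp_pos (- pz A0)).
    destruct V as [[V1 V2]|[V1 V2]]; simpl in V1, V2;
      apply Rmult_integral in V1, V2.
    + assert (E1 : px A1 = px A0) by lra. assert (E2 : px A2 = px A0) by lra.
      set (B1 := untrans A0 P1) in *. set (B2 := untrans A0 P2) in *.
      apply (Hequation (fun X =>
        (py X * height X - py B1 * height B1) * (height B2 - height B1)
        - (height X - height B1) * (py B2 * height B2 - py B1 * height B1))).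
      * intros s A B X (_ & Hq & Hh). rewrite Hq, Hh. ring.
      * intros X HX. apply Hl' in HX. destruct HX as (s & _ & Hq & Hh). rewrite Hq, Hh. ring.
      * intros X HX E. apply Hl', divides_of_plane; [exact HPu|left].
        assert (px X = px A0) by (destruct HX as [->|[->| ->]]; auto).
        assert (Hu : forall Y, px Y = px A0 -> px (untrans A0 Y) = 0)
          by (intros Y HY; unfold untrans; simpl; rewrite HY; ring).
        unfold B1 at 1 2, B2 at 1. rewrite !Hu by auto.
        repeat split; lra.
    + assert (E1 : py A1 = py A0) by lra. assert (E2 : py A2 = py A0) by lra.
      set (B1 := untrans A0 P1) in *. set (B2 := untrans A0 P2) in *.
      apply (Hequation (fun X =>
        (px X - px B1) * (height B2 - height B1)
        - (height X - height B1) * (px B2 - px B1))).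
      * intros s A B X (Hx & _ & Hh). rewrite Hx, Hh. ring.
      * intros X HX. apply Hl' in HX. destruct HX as (s & Hx & _ & Hh). rewrite Hx, Hh. ring.
      * intros X HX E. apply Hl', divides_of_plane; [exact HPu|right].
        assert (py X = py A0) by (destruct HX as [->|[->| ->]]; auto).
        assert (Hu : forall Y, py Y = py A0 -> py (untrans A0 Y) = 0)
          by (intros Y HY; unfold untrans; simpl; rewrite HY; ring).
        unfold B1 at 1 2, B2 at 1. rewrite !Hu by auto.
        repeat split; lra.
  - set (B1 := untrans A0 P1) in *. set (B2 := untrans A0 P2) in *.
    destruct (excluded_middle_informative (proj B1 = proj B2)) as [E|E].
    + apply (Hequation (fun X => px X - px B1)).
      * intros s A B X (Hx & _). rewrite Hx. ring.
      * intros X HX. apply Hl in HX.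
        assert (px (untrans A0 X) = px B1) by tauto. lra.
      * intros X HX EX. apply Hl. right; right. repeat split; auto. lra.
    + apply (Hequation (fun X =>
        (px X - px B1) * (height B2 - height B1)
        - (height X - height B1) * (px B2 - px B1))).
      * intros s A B X (Hx & _ & Hh). rewrite Hx, Hh. ring.
      * intros X HX. apply Hl in HX.
        assert (HL : eline (mmap (proj B1)) (mmap (proj B2)) (mmap (proj (untrans A0 X))))
          by tauto.
        destruct HL as [s HL].
        change ((px (untrans A0 X), height (untrans A0 X)) =
          (px B1 + s * (px B2 - px B1), height B1 + s * (height B2 - height B1))) in HL.
        injection HL as Hx Hh. change (px (untrans A0 X) = px B1 + s * (px B2 - px B1)) in Hx.
        rewrite Hh, Hx. ring.
      * intros X HX EX. apply Hl. right; left. repeat split; auto.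
        destruct (collinear_param (px B1) (height B1) (px B2) (height B2)
          (px (untrans A0 X)) (height (untrans A0 X))) as (s & Hu & Hv); [|lra|].
        -- destruct (Req_dec (height B1) (height B2)) as [Eh|]; [left|auto].
           intro Ex; apply E. unfold proj. rewrite Ex. unfold height in Eh.
           apply exp_inv in Eh. f_equal; lra.
        -- exists s.
           change ((px (untrans A0 X), height (untrans A0 X)) =
             (px B1 + s * (px B2 - px B1), height B1 + s * (height B2 - height B1))).
           rewrite Hu, Hv. f_equal; ring.
Qed.

(** * The telescoping product *)

(** [F X = (1 - s) * F A + s * F B] vanishes, which determines the ratio. *)
Lemma divides_zero (F : Sol -> R) (A B X : Sol) :
  chart_affine F -> F X = 0 -> F A <> 0 -> F B <> 0 ->
  (exists s, divides s A B X) ->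
  exists s, divides s A B X /\ s <> 0 /\ s <> 1 /\ s / (1 - s) = - (F A / F B).
Proof.
  intros HF HX HA HB [s Hs]. exists s. split; [exact Hs|].
  apply HF in Hs. rewrite HX in Hs.
  assert (s <> 0) by (intros ->; apply HA; lra).
  assert (s <> 1) by (intros ->; apply HB; lra).
  repeat split; auto.
  apply (Rmult_eq_reg_r ((1 - s) * F B)).
  - field_simplify; lra.
  - apply Rmult_integral_contrapositive; split; lra.
Qed.

Lemma simple_ratio_equation (F : Sol -> R) (A B X : Sol) :
  A <> B -> chart_affine F -> F X = 0 -> F A <> 0 -> F B <> 0 ->
  (exists s, divides s A B X) ->
  ~ in_z_axis (side A B) ->
  ((in_yz (side A B) -> in_xy (side A B)) -> simple_ratio A X B = - (F A / F B)) /\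
  (in_yz (side A B) ->
   simple_ratio A X B = - ((F A / height A) / (F B / height B))).
Proof.
  intros HAB HF HX HA HB Hs Hz.
  destruct (divides_zero F A B X) as (s & Hd & H0 & H1 & Hr); auto.
  pose proof (height_pos A); pose proof (height_pos B).
  split; intro Hy.
  - rewrite <- Hr. apply simple_ratio_divides; auto.
  - rewrite (simple_ratio_divides_yz s) by auto.
    transitivity (s / (1 - s) * (height B / height A)); [field; lra|].
    rewrite Hr. field. lra.
Qed.

Theorem theorem3p25 (A0 A1 A2 : Sol) (htri : translation_triangle A0 A1 A2)
  (hsides : compatible_sides A0 A1 A2)
  (l : Sol -> Prop) (hl : surface_line A0 A1 A2 l)
  (hl0 : ~ l A0) (hl1 : ~ l A1) (hl2 : ~ l A2)
  (Q R' P : Sol)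
  (hQ : l Q /\ gcurve A1 A2 Q)
  (hR : l R' /\ gcurve A0 A2 R')
  (hP : l P /\ gcurve A0 A1 P) :
  simple_ratio A0 P A1 * simple_ratio A1 Q A2 * simple_ratio A2 R' A0 = -1.
Proof.
  destruct (triangle_distinct _ _ _ htri) as (H01 & H12 & H02).
  destruct hQ as [lQ gQ], hR as [lR gR], hP as [lP gP].
  apply gcurve_divides in gQ, gR, gP; auto.
  assert (gR' : exists s, divides s A2 A0 R').
  { destruct gR as [s Hs]. exists (1 - s). apply divides_sym, Hs. }
  destruct (surface_line_equation _ _ _ _ htri hl hl0 hl1 hl2)
    as (F & HF & Hl & F0 & F1 & F2).
  destruct hsides as ((Z1 & Z2 & Z3) & Hs).
  destruct (simple_ratio_equation F A0 A1 P) as [X1 Y1]; auto.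
  destruct (simple_ratio_equation F A1 A2 Q) as [X2 Y2]; auto.
  destruct (simple_ratio_equation F A2 A0 R') as [X3 Y3]; auto.
  pose proof (height_pos A0); pose proof (height_pos A1); pose proof (height_pos A2).
  destruct Hs as [(S1 & S2 & S3)|(S1 & S2 & S3)].
  - rewrite Y1, Y2, Y3 by auto. field. repeat split; lra.
  - rewrite X1, X2, X3 by auto. field. auto.
Qed.
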